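(* Let $G$ be a finite simple connected graph, $G_1,G_2$ disjoint copies of $G$, and $f:V(G_1)\to V(G_2)$ a function. Then $\gamma(G)=\gamma(C(G,f))$ if and only if there are sets $D_1\subseteq V(G_1)$ and $D_2\subseteq V(G_2)$ such that: (1) $D_1$ dominates $V(G_1)\setminus f^{-1}(D_2)$ (in $G_1$); (2) $D_2$ dominates $V(G_2)\setminus f(D_1)$ (in $G_2$); (3) $D_2\cup f(D_1)$ is a minimum dominating set of $G_2$; (4) $|D_1|=|f(D_1)|$; (5) $D_2\cap f(D_1)=\emptyset$; and (6) $D_1\cap f^{-1}(D_2)=\emptyset$.
   Context: For disjoint copies $G_1,G_2$ of a graph $G$ and a function $f:V(G_1)\to V(G_2)$, the functigraph $C(G,f)$ has vertex set $V(G_1)\cup V(G_2)$ and edge set $E(G_1)\cup E(G_2)\cup\{uv : u\in V(G_1), v\in V(G_2), v=f(u)\}$. $\gamma(H)$ denotes the domination number of $H$. A set $D$ dominates a set $S$ if every vertex of $S\setminus D$ has a neighbor in $D$. For $S\subseteq V(G_2)$, $f^{-1}(S)=\{v\in V(G_1): f(v)\in S\}$. *)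

(* Defs.v *)
From mathcomp Require Import all_boot.
Set Implicit Arguments.
Unset Strict Implicit.
Unset Printing Implicit Defensive.

Record sgraph := SGraph {
  vertex :> finType;
  adj : rel vertex;
  adj_sym : symmetric adj;
  adj_irrefl : irreflexive adj }.

Definition connected (G : sgraph) : Prop :=
  forall x y : G, connect (@adj G) x y.

Definition dominates (G : sgraph) (D S : {set G}) : bool :=
  [forall x in S :\: D, [exists y in D, adj x y]].

Definition dominating (G : sgraph) (D : {set G}) : bool :=
  dominates D [set: G].

(* The full vertex set is always dominating (see dominating_setT), so the
   minimum is taken over a nonempty family. *)
Definition gamma (G : sgraph) : nat :=
  #|[arg min_(D < [set: G] | dominating D) #|D|]|.

Lemma dominating_setT (G : sgraph) : dominating [set: G].
Proof. by apply/forall_inP => x; rewrite !inE. Qed.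

Definition minimum_dominating (G : sgraph) (D : {set G}) : bool :=
  dominating D && (#|D| == gamma G).

Section Functigraph.

Variables (G : sgraph) (f : G -> G).

(* The two disjoint copies of G are the two summands of G + G, so a map between
   the copies is a map f : G -> G, and subsets of either copy are sets over G. *)
Definition functi_adj : rel (G + G) := fun a b =>
  match a, b with
  | inl u, inl v => adj u v
  | inr u, inr v => adj u v
  | inl u, inr v => v == f u
  | inr v, inl u => v == f u
  end.

Lemma functi_adj_sym : symmetric functi_adj.
Proof. by move=> [u|u] [v|v] //=; apply: adj_sym. Qed.

Lemma functi_adj_irrefl : irreflexive functi_adj.
Proof. by move=> [u|u] /=; apply: adj_irrefl. Qed.

Definition functigraph : sgraph := SGraph functi_adj_sym functi_adj_irrefl.

End Functigraph.

(* Main.v *)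
(* A dominating set of C(G,f) is a disjoint union of D1 and D2 satisfying (1)
   and (2). Pushing D1 forward along f gives a dominating set D2 :|: f(D1) of G
   with at most #|D1| + #|D2| vertices, so gamma(G) <= gamma(C(G,f)), and
   equality holds exactly when no vertex is lost in taking the image and the
   union, which is (3)-(5); (6) is a restatement of (5). *)
Require Import Defs.
From mathcomp Require Import all_boot.

Set Implicit Arguments.
Unset Strict Implicit.
Unset Printing Implicit Defensive.

Lemma dominatesP (G : sgraph) (D S : {set G}) :
  reflect (forall x, x \in S -> x \notin D -> exists2 y, y \in D & adj x y)
          (dominates D S).
Proof.
apply: (iffP forall_inP) => [H x xS xD|H x].
  by apply/exists_inP/H; rewrite inE xD xS.
by rewrite inE => /andP[xD xS]; apply/exists_inP/H.
Qed.

Lemma gamma_le (G : sgraph) (D : {set G}) : dominating D -> gamma G <= #|D|.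
Proof.
by rewrite /gamma; case: arg_minnP => [|E _ minE /minE]; first exact: dominating_setT.
Qed.

Lemma gamma_witness (G : sgraph) : exists2 D : {set G}, dominating D & #|D| = gamma G.
Proof.
rewrite /gamma; case: arg_minnP => [|D domD _]; first exact: dominating_setT.
by exists D.
Qed.

Section FunctigraphDomination.

Variables (G : sgraph) (f : G -> G).

Definition pair_set (D1 D2 : {set G}) : {set functigraph f} :=
  [set a : G + G | match a with inl u => u \in D1 | inr v => v \in D2 end].

Lemma pair_set_surj (D : {set functigraph f}) :
  exists D1 D2, D = pair_set D1 D2.
Proof.
exists [set u | (inl u : functigraph f) \in D], [set v | (inr v : functigraph f) \in D].
by apply/setP => -[u|v]; rewrite !inE.
Qed.

Lemma card_pair_set (D1 D2 : {set G}) : #|pair_set D1 D2| = #|D1| + #|D2|.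
Proof.
(* The summands are given explicitly because the vertex type of [functigraph f] shows its sum
   structure only after unfolding. *)
rewrite -!sum1_card (@big_sumType _ _ _ G G) /=.
by congr (_ + _); apply: eq_bigl => u; rewrite inE.
Qed.

(** A vertex [x] of the first copy has [f x] as its only neighbor across, so it needs help inside
    its copy unless [f x] lies in [D2]. A vertex of the second copy has its preimages as neighbors
    across, so it is already covered exactly when it lies in [f @: D1]. *)
Lemma dominating_pair_set (D1 D2 : {set G}) :
  dominating (pair_set D1 D2) <->
  dominates D1 ([set: G] :\: f @^-1: D2) /\ dominates D2 ([set: G] :\: f @: D1).
Proof.
split=> [/dominatesP dom|[/dominatesP dom1 /dominatesP dom2]].
  split; apply/dominatesP => x; rewrite !inE andbT => xN xD.
    have [||[y|y]] := dom (inl x); rewrite ?inE //= => yD; first by exists y.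
    by move=> /eqP yE; rewrite yE (negPf xN) in yD.
  have [||[y|y]] := dom (inr x); rewrite ?inE //= => yD; last by exists y.
  by move=> /eqP xE; rewrite xE imset_f in xN.
apply/dominatesP => -[x|x] _; rewrite inE => xD.
  have [fx|fx] := boolP (f x \in D2); first by exists (inr (f x)); rewrite ?inE /=.
  have [||y yD xy] := dom1 x; rewrite ?inE ?fx //.
  by exists (inl y); rewrite ?inE.
have [/imsetP[u uD xE]|fx] := boolP (x \in f @: D1).
  by exists (inl u); rewrite ?inE //= xE.
have [||y yD xy] := dom2 x; rewrite ?inE ?fx //.
by exists (inr y); rewrite ?inE.
Qed.

(** The only vertices that [D2] may fail to dominate lie in [f @: D1], and these now belong to the
    set itself. *)
Lemma dominating_push (D1 D2 : {set G}) :
  dominates D2 ([set: G] :\: f @: D1) -> dominating (D2 :|: f @: D1).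
Proof.
move=> /dominatesP dom; apply/dominatesP => x _.
rewrite inE negb_or => /andP[xD xf].
have [||y yD xy] := dom x; rewrite ?inE ?xf //.
by exists y; rewrite // inE yD.
Qed.

Lemma card_push (D1 D2 : {set G}) : #|D2 :|: f @: D1| <= #|D1| + #|D2|.
Proof.
rewrite addnC; apply: leq_trans (leq_card_setU _ _).1 _.
by rewrite leq_add2l leq_imset_card.
Qed.

Lemma gamma_functigraph_ge : gamma G <= gamma (functigraph f).
Proof.
have [D] := gamma_witness (functigraph f).
have [D1 [D2 ->]] := pair_set_surj D.
rewrite card_pair_set => /dominating_pair_set[_ dom2] <-.
exact: leq_trans (gamma_le (dominating_push dom2)) (card_push _ _).
Qed.

End FunctigraphDomination.

Theorem theorem3p1 (G : sgraph) (f : G -> G) (hG : connected G) :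
  gamma G = gamma (functigraph f) <->
  exists D1 D2 : {set G},
    dominates D1 ([set: G] :\: f @^-1: D2) /\
    dominates D2 ([set: G] :\: f @: D1) /\
    minimum_dominating (D2 :|: f @: D1) /\
    #|D1| = #|f @: D1| /\
    D2 :&: f @: D1 = set0 /\
    D1 :&: f @^-1: D2 = set0.
Proof.
split=> [gE|[D1 [D2 [dom1 [dom2 [/andP[_ /eqP minD] [cardf [dis _]]]]]]]].
  have [D] := gamma_witness (functigraph f).
  have [D1 [D2 ->]] := pair_set_surj D.
  rewrite card_pair_set -gE => /dominating_pair_set[dom1 dom2] cardD.
  have domU := dominating_push dom2.
  have geU := gamma_le domU.
  have leU := card_push f D1 D2.
  (* The size is squeezed between [gamma G] and [#|D1| + #|D2|], which are equal by [cardD]. *)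
  have cardU : #|D2 :|: f @: D1| = gamma G.
    by apply/eqP; rewrite eqn_leq geU -cardD leU.
  have lef : #|f @: D1| <= #|D1| by apply: leq_imset_card.
  have := cardsUI D2 (f @: D1); rewrite cardU -cardD => cardUI.
  (* Inclusion-exclusion after cancelling [#|D2|]. As an image is no larger than its source, this
     one equation forces both (4) and (5). *)
  have tight : #|D1| + #|D2 :&: f @: D1| = #|f @: D1|.
    by apply/eqP; rewrite -(eqn_add2l #|D2|) -cardUI addnCA addnA.
  have cardf : #|D1| = #|f @: D1|.
    by apply/eqP; rewrite eqn_leq lef -tight leq_addr.
  have dis : D2 :&: f @: D1 = set0.
    by apply/eqP; rewrite -cards_eq0 -(eqn_add2l #|D1|) tight addn0 cardf.
  have minU : minimum_dominating (D2 :|: f @: D1).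
    by rewrite /minimum_dominating domU cardU eqxx.
  exists D1, D2; do 5!(split; first by []).
  (* For (6), a common element [x] would put [f x] into the empty set of (5). *)
  apply/setP => x; rewrite !inE; apply/negP => /andP[xD fxD].
  by have := in_set0 (f x); rewrite -dis inE fxD imset_f.
(* Only the upper bound on [gamma (functigraph f)] remains. By (4) and (5), [pair_set f D1 D2] has
   as many vertices as [D2 :|: f @: D1], that is [gamma G]. *)
apply/eqP; rewrite eqn_leq gamma_functigraph_ge /= -minD cardsU dis cards0 subn0.
rewrite -cardf addnC -(card_pair_set f); apply: gamma_le.
exact/dominating_pair_set.
Qed.
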